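(* Let $G$ be a finite group. Then the Zagreb indices of $\mathcal{B}(G)$ are given by \[ M_1(\mathcal{B}(G))=|G|^2+|G|^4 \sum_{H \in L(G)}\left(\Pr\nolimits_H(G)\right)^2 \quad\text{and}\quad M_2(\mathcal{B}(G))= M_1(\mathcal{B}(G))-|G|^2. \]
   Context: For a finite group $G$, $L(G)$ denotes the set of all subgroups of $G$. The subgroup generating bipartite graph $\mathcal{B}(G)$ is the simple undirected bipartite graph whose vertex set is the disjoint union $(G\times G)\sqcup L(G)$, where $(a,b)\in G\times G$ and $H\in L(G)$ are adjacent if and only if $H=\langle a,b\rangle$ (the subgroup generated by $a$ and $b$); there are no other edges. For a subgroup $H$ of $G$, $\Pr_H(G)$ is the probability that a uniformly random pair $(a,b)\in G\times G$ generates $H$, i.e. $\Pr_H(G)=|\{(a,b)\in G\times G:\langle a,b\rangle=H\}|/|G|^2$. For a finite simple graph $\mathcal{G}$ with vertex set $V(\mathcal{G})$ and edge set $e(\mathcal{G})$, the first and second Zagreb indices are $M_1(\mathcal{G})=\sum_{v\in V(\mathcal{G})}\deg(v)^2$ and $M_2(\mathcal{G})=\sum_{uv\in e(\mathcal{G})}\deg(u)\deg(v)$. *)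

(* Defs.v *)
From mathcomp Require Import all_boot all_order all_fingroup all_algebra.

Set Implicit Arguments.
Unset Strict Implicit.
Unset Printing Implicit Defensive.

Import GroupScope.

Record sgraph := SGraph {
  vertex :> finType;
  adj : rel vertex;
  adj_sym : symmetric adj;
  adj_irrefl : irreflexive adj
}.

Definition deg (V : sgraph) (v : V) : nat := #|[set w | adj v w]|.

(* An undirected edge is the two-element set of its endpoints, so that each
   edge occurs once. *)
Definition edges (V : sgraph) : {set {set V}} :=
  [set [set p.1; p.2] | p : V * V & adj p.1 p.2].

Definition zagreb1 (V : sgraph) : nat := (\sum_(v : V) deg v ^ 2)%N.

(* The endpoints of an edge are distinct, so the inner product has exactly the
   two factors deg u and deg v. *)
Definition zagreb2 (V : sgraph) : nat :=
  (\sum_(e in edges V) \prod_(v in e) deg v)%N.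

Section SubgroupGeneratingBipartiteGraph.

Variables (gT : finGroupType) (G : {group gT}).

Definition sgb_vertex : finType :=
  ({ab : gT * gT | ab \in setX G G} + {H : {group gT} | H \in subgroups G})%type.

Definition sgb_adj : rel sgb_vertex := fun u v =>
  match u, v with
  | inl ab, inr H | inr H, inl ab =>
      val H :==: <<[set (val ab).1; (val ab).2]>>
  | _, _ => false
  end.

Lemma sgb_adj_sym : symmetric sgb_adj.
Proof. by move=> [ab|H] [cd|K]. Qed.

Lemma sgb_adj_irrefl : irreflexive sgb_adj.
Proof. by case. Qed.

Definition sgb_graph : sgraph := SGraph sgb_adj_sym sgb_adj_irrefl.

Definition gen_prob (H : {group gT}) : rat :=
  (#|[set ab in setX G G | <<[set ab.1; ab.2]>> == H]|%:R / #|G|%:R ^+ 2)%R.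

End SubgroupGeneratingBipartiteGraph.

(* Main.v *)
Require Import Defs.
From mathcomp Require Import all_boot all_order all_fingroup all_algebra.

Set Implicit Arguments.
Unset Strict Implicit.
Unset Printing Implicit Defensive.

Import GRing.Theory Num.Theory.

(** In the graph of a finite group [G] each pair is adjacent to exactly one
    subgroup, the one it generates: the graph is that of the function
    [sgb_gen] from pairs to subgroups.  Hence a pair has degree 1, and a
    subgroup [H] has degree [#|G| ^ 2 * gen_prob G H], the size of its fibre
    ([deg_pair], [deg_subgroup], [deg_subgroup_prob]).

    The sum of the squared degrees is therefore [#|G| ^ 2], from the pairs,
    plus the sum of the squared fibre sizes, from the subgroups.  The edges
    correspond to the pairs, and the edge at [ab] has weight
    [1 * deg (sgb_gen ab)]; a subgroup [H] receives this weight once for each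
    element of its fibre, so summing over the edges gives the sum of the
    squared fibre sizes again ([sum_fibre_card]), that is, the first index
    without the contribution of the pairs. *)

(** Grouping the sum by fibres, the fibre over [b] contributes [d b] terms all
    equal to [d b]. *)
Lemma sum_fibre_card (A B : finType) (f : A -> B) (d : B -> nat) :
    (forall b, d b = #|[set a | f a == b]|) ->
  \sum_a d (f a) = \sum_b d b ^ 2.
Proof.
move=> dE; rewrite (partition_big f predT) //=; apply: eq_bigr => b _.
rewrite (eq_bigr (fun=> d b)) => [|a /eqP->//].
by rewrite sum_nat_const expnS expn1 {2}dE cardsE.
Qed.

Section PairDegrees.

Variables (gT : finGroupType) (G : {group gT}).

Local Notation pair := {ab : gT * gT | ab \in setX G G}.
Local Notation subgroup := {H : {group gT} | H \in subgroups G}.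
Local Notation V := (sgb_graph G).

Lemma gen_pair_subgroup (ab : pair) :
  <<[set (val ab).1; (val ab).2]>>%G \in subgroups G.
Proof.
have /setXP[aG bG] : ((val ab).1, (val ab).2) \in setX G G.
  by rewrite -surjective_pairing (valP ab).
by rewrite inE gen_subG subUset !sub1set aG.
Qed.

Definition sgb_gen (ab : pair) : subgroup :=
  exist (fun H => H \in subgroups G) _ (gen_pair_subgroup ab).

Lemma sgb_adj_gen (ab : pair) (H : subgroup) :
  @adj V (inl ab) (inr H) = (sgb_gen ab == H).
Proof. by rewrite eq_sym. Qed.

Lemma deg_pair (ab : pair) : @deg V (inl ab) = 1%N.
Proof.
rewrite /deg -(cards1 (inr (sgb_gen ab) : V)); apply: eq_card => -[cd|H].
  by rewrite !inE.
by rewrite in_set in_set1 sgb_adj_gen eq_sym.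
Qed.

Lemma deg_subgroup (H : subgroup) :
  @deg V (inr H) = #|[set ab | sgb_gen ab == H]|.
Proof.
rewrite /deg -(card_imset _ (@inl_inj pair subgroup)).
apply: eq_card => -[ab|K]; rewrite in_set.
  by rewrite (mem_imset _ _ inl_inj) in_set adj_sym sgb_adj_gen.
by apply/esym/imsetP; case.
Qed.

Lemma card_pair : #|{: pair}| = (#|G| ^ 2)%N.
Proof. by rewrite card_sig cardsX mulnn. Qed.

Lemma zagreb1_sgb :
  zagreb1 V = (#|G| ^ 2 + \sum_(H : subgroup) @deg V (inr H) ^ 2)%N.
Proof.
rewrite /zagreb1 big_sumType /=; congr addn.
rewrite (eq_bigr (fun=> 1%N)) => [|ab _]; last by rewrite deg_pair.
by rewrite sum1_card card_pair.
Qed.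

Definition pair_edge (ab : pair) : {set V} :=
  [set inl ab; inr (sgb_gen ab)].

(** Every edge has only one endpoint among the pairs, so it determines its
    pair; sums over edges thereby become sums over pairs. *)
Lemma pair_edge_inj : injective pair_edge.
Proof.
move=> ab cd /setP/(_ (inl ab)).
by rewrite /pair_edge !inE eqxx /= orbF => /esym/eqP[].
Qed.

Lemma edges_sgb : edges V = pair_edge @: [set: pair].
Proof.
apply/setP=> e; apply/imsetP/imsetP=> [[[u v] uv ->]|[ab _ ->]]; last first.
  exists (inl ab, inr (sgb_gen ab)) => //.
  have := sgb_adj_gen ab (sgb_gen ab); rewrite eqxx => abE.
  by rewrite inE.
move: uv; rewrite inE [_.1]/= [_.2]/=.
case: u v => [ab|H] [cd|K] //.
  by rewrite sgb_adj_gen => /eqP<-; exists ab.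
by rewrite adj_sym sgb_adj_gen => /eqP<-; exists cd; rewrite // setUC.
Qed.

Lemma zagreb2_sgb :
  zagreb2 V = (\sum_(H : subgroup) @deg V (inr H) ^ 2)%N.
Proof.
rewrite /zagreb2 edges_sgb big_imset /=; last by move=> ? ? _ _ /pair_edge_inj.
rewrite -(sum_fibre_card deg_subgroup).
apply: eq_big => [ab|ab _]; first by rewrite in_setT.
by rewrite big_setU1 ?in_set1 //= big_set1 deg_pair mul1n.
Qed.

Local Open Scope ring_scope.

(** Here the fibre of [sgb_gen] over [H], a set of elements of a subtype, is
    identified with the set of elements of [gT * gT] that [gen_prob] counts. *)
Lemma deg_subgroup_prob (H : subgroup) :
  (@deg V (inr H))%:R = #|G|%:R ^+ 2 * gen_prob G (val H) :> rat.
Proof.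
rewrite /gen_prob mulrC divfK; last by rewrite expf_neq0 ?pnatr_eq0 -?lt0n.
congr _%:R; rewrite deg_subgroup -(card_imset _ (@val_inj _ _ pair)).
apply: eq_card => ab; apply/imsetP/idP => [[cd]|].
  rewrite in_set => /eqP<- ->; rewrite in_set (valP cd); exact: eqxx.
rewrite inE => /andP[abG abH].
exists (exist (fun x => x \in setX G G) ab abG) => //.
by rewrite inE; apply/eqP/val_inj/group_inj/eqP.
Qed.

Lemma sum_deg_subgroup_sqr :
  (\sum_(H : subgroup) @deg V (inr H) ^ 2)%:R =
    #|G|%:R ^+ 4 * \sum_(H in subgroups G) gen_prob G H ^+ 2 :> rat.
Proof.
rewrite natr_sum mulr_sumr [RHS]big_sub /=; apply: eq_bigr => H _.
by rewrite natrX deg_subgroup_prob exprMn -exprM.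
Qed.

End PairDegrees.

Local Open Scope ring_scope.

Theorem theorem3p1 (gT : finGroupType) (G : {group gT}) :
  (zagreb1 (sgb_graph G))%:R =
    #|G|%:R ^+ 2 +
    #|G|%:R ^+ 4 * \sum_(H in subgroups G) gen_prob G H ^+ 2 :> rat
  /\
  (zagreb2 (sgb_graph G))%:R =
    (zagreb1 (sgb_graph G))%:R - #|G|%:R ^+ 2 :> rat.
Proof.
rewrite zagreb1_sgb zagreb2_sgb natrD natrX sum_deg_subgroup_sqr.
by split; rewrite // addrC addKr.
Qed.
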